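(* Let $p\ge1$ be an integer, let $\mu\ne0$ be a fixed real frequency, and let $0<h<1$. Consider the $C^{p-1}$ B-splines $\theta^j_p$ of degree $p$ on the uniform grid of size $h$ on the real line, with exact stiffness entries $A^{j+k}_p$ and with the mass entries replaced by the dispersion-minimized mass entries $B^{j+k}_{p,O}$. Let $\omega_h$ be the corresponding discrete mode associated with the Bloch wave of frequency $\mu$: $$\omega_h^2=\frac{1}{h^2}\,\frac{A^j_p+2\sum_{k=1}^pA^{j+k}_p\cos(k\mu h)}{B^j_{p,O}+2\sum_{k=1}^pB^{j+k}_{p,O}\cos(k\mu h)}.$$ Then, as $h\to0$, $$\omega_h^2-\mu^2=2(-1)^{p}\left(\sum_{k=1}^p\left(\frac{k^{2p+4}}{(2p+4)!}A^{j+k}_p+\frac{k^{2p+2}}{(2p+2)!}B^{j+k}_{p,O}\right)\right)\mu^{2p+4}h^{2p+2}+\mathcal O(h^{2p+4}).$$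
   Context: Uniform knots $x_j=jh$, $j\in\mathbb Z$, $h>0$, on the real line. The B-splines are defined by $\theta^j_0=1$ on $[x_j,x_{j+1})$ and $0$ otherwise, and $$\theta^j_p(x)=\frac{x-x_j}{x_{j+p}-x_j}\theta^j_{p-1}(x)+\frac{x_{j+p+1}-x}{x_{j+p+1}-x_{j+1}}\theta^{j+1}_{p-1}(x).$$ The stiffness entries are $A^{j+k}_p=h\int(\theta^j_p)'(\theta^{j+k}_p)'\,dx$, $k\in\mathbb Z$ (piecewise derivatives when $p=1$); they do not depend on $h$ or $j$, satisfy $A^{j-k}_p=A^{j+k}_p$, and vanish for $|k|>p$. Dispersion-minimized mass entries: the vector $(B^{j+1}_{p,O},\dots,B^{j+p}_{p,O})$ is the unique solution of the $p\times p$ linear system $\aleph\,(B^{j+1}_{p,O},\dots,B^{j+p}_{p,O})^T=-\tilde\aleph\,(A^{j+1}_p,\dots,A^{j+p}_p)^T$, where $\aleph_{m,k}=\frac{k^{2m}}{(2m)!}$ and $\tilde\aleph_{m,k}=\frac{k^{2m+2}}{(2m+2)!}$ for $1\le m,k\le p$ (the matrix $\aleph$ is invertible). These are extended by $B^{j-k}_{p,O}=B^{j+k}_{p,O}$ for $k=1,\dots,p$ and $B^j_{p,O}=1-2\sum_{k=1}^pB^{j+k}_{p,O}$. The formula for $\omega_h^2$ comes from testing the discrete Helmholtz equation (with mass entries $B_{p,O}$) with $\theta^j_p$ and inserting Bloch coefficients $U^l=e^{il\mu h}$, $i^2=-1$. *)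

(* Defs.v *)
From HB Require Import structures.
From mathcomp Require Import all_boot all_order all_algebra.
From mathcomp Require Import all_classical all_reals all_analysis.

Set Implicit Arguments.
Unset Strict Implicit.
Unset Printing Implicit Defensive.

Import Order.TTheory GRing.Theory Num.Theory.
Import numFieldNormedType.Exports.

Local Open Scope classical_set_scope.
Local Open Scope ring_scope.

Definition knot (R : realType) (h : R) (j : int) : R := j%:~R * h.

Fixpoint bspline (R : realType) (h : R) (p : nat) (j : int) (x : R) : R :=
  match p with
  | 0%N => if knot h j <= x < knot h (j + 1) then 1 else 0
  | q.+1 =>
      (x - knot h j) / (knot h (j + q.+1%:Z) - knot h j) * bspline h q j x
      + (knot h (j + q.+2%:Z) - x) / (knot h (j + q.+2%:Z) - knot h (j + 1))
          * bspline h q (j + 1) x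
  end.

(* [stiffness h p j k] is A^{j+k}_p.  For p = 1 the function [derive1] takes
   unspecified values at the (finitely many) kinks of the hat functions; this
   is a Lebesgue-null set, so the integral is that of the piecewise
   derivatives. *)
Definition stiffness (R : realType) (h : R) (p : nat) (j k : int) : R :=
  h * Rintegral (@lebesgue_measure R) [set: R]
        (fun x : R => derive1 (bspline h p j) x * derive1 (bspline h p (j + k)) x).

(* Row and column i : 'I_p stand for the index i + 1 in {1, .., p}. *)
Definition aleph (R : realType) (p : nat) : 'M[R]_p :=
  \matrix_(m < p, k < p) (k.+1%:R ^+ (2 * m.+1) / ((2 * m.+1)`!)%:R).

Definition aleph_tilde (R : realType) (p : nat) : 'M[R]_p :=
  \matrix_(m < p, k < p)
    (k.+1%:R ^+ (2 * m.+1 + 2) / ((2 * m.+1 + 2)`!)%:R).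

Definition stiffness_vec (R : realType) (h : R) (p : nat) (j : int)
  : 'cV[R]_p := \col_(k < p) stiffness h p j k.+1%:Z.

(* (B^{j+1}_{p,O}, .., B^{j+p}_{p,O}); by [mass_vecP] it is the unique solution
   of the linear system defining it. *)
Definition mass_vec (R : realType) (h : R) (p : nat) (j : int) : 'cV[R]_p :=
  invmx (aleph R p) *m - (aleph_tilde R p *m stiffness_vec h p j).

Lemma aleph_unit (R : realType) (p : nat) : aleph R p \in unitmx.
Proof.
pose d1 : 'rV[R]_p := \row_m (((2 * m.+1)`!)%:R)^-1.
pose d2 : 'rV[R]_p := \row_k (k.+1%:R ^+ 2).
have -> : aleph R p = diag_mx d1 *m Vandermonde p d2 *m diag_mx d2.
  apply/matrixP => m k; rewrite mul_mx_diag mxE mul_diag_mx !mxE.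
  by rewrite mulrC -mulrA -exprSr -exprM.
rewrite !unitmx_mul !unitmxE !det_diag det_Vandermonde !unitfE.
apply/andP; split; [apply/andP; split |].
- by apply/prodf_neq0 => i _; rewrite mxE invr_eq0 pnatr_eq0 -lt0n fact_gt0.
- apply/prodf_neq0 => i _; apply/prodf_neq0 => k ik.
  rewrite !mxE subr_eq0 -!natrX eqr_nat eqn_exp2r// eqSS.
  by rewrite eq_sym; move: ik; rewrite ltn_neqAle => /andP[].
- by apply/prodf_neq0 => i _; rewrite mxE expf_neq0// pnatr_eq0.
Qed.

Lemma mass_vecP (R : realType) (h : R) (p : nat) (j : int) (b : 'cV[R]_p) :
  aleph R p *m b = - (aleph_tilde R p *m stiffness_vec h p j) <->
  b = mass_vec h p j.
Proof.
rewrite /mass_vec; split => [<-|->]; first by rewrite mulKmx ?aleph_unit.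
by rewrite mulKVmx ?aleph_unit.
Qed.

(* [mass_opt h p j k] is B^{j+k}_{p,O}, for k in {-p, .., p}; it is extended by
   0 to |k| > p. *)
Definition mass_opt (R : realType) (h : R) (p : nat) (j k : int) : R :=
  match `|k|%N with
  | 0%N => 1 - 2 * \sum_(i < p) mass_vec h p j i ord0
  | n.+1 => if insub n is Some i then mass_vec h p j i ord0 else 0
  end.

Definition omega_sq (R : realType) (p : nat) (mu : R) (j : int) (h : R) : R :=
  (h ^+ 2)^-1 *
  ((stiffness h p j 0
    + 2 * \sum_(1 <= k < p.+1) stiffness h p j k%:Z * cos (k%:R * mu * h))
   / (mass_opt h p j 0
    + 2 * \sum_(1 <= k < p.+1) mass_opt h p j k%:Z * cos (k%:R * mu * h))).

(* Main.v *)
Require Import Defs.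
From HB Require Import structures.
From mathcomp Require Import all_boot all_order all_algebra.
From mathcomp Require Import all_classical all_reals all_analysis.
From mathcomp Require Import measurable_realfun.
From mathcomp Require Import ring lra.

Set Implicit Arguments.
Unset Strict Implicit.
Unset Printing Implicit Defensive.

Import Order.TTheory GRing.Theory Num.Theory.
Import numFieldNormedType.Exports.

Local Open Scope classical_set_scope.
Local Open Scope ring_scope.

(** Put t = mu h and let N(t) and D(t) be the trigonometric polynomials with the
    stiffness and the mass coefficients, so that omega_h^2 = N(t) / (h^2 D(t)).
    Since omega_h^2 - mu^2 = (N - t^2 D) / (h^2 D), everything depends on the
    Taylor coefficients of N - t^2 D at 0.  These are combinations of the moments
    of A and B.  The linear system defining B says exactly that the coefficients
    of t^4, ..., t^(2p+2) vanish ([moment_mass]); the coefficient of t^(2p+4) is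
    the constant of the theorem, and D = 1 + O(t^2) because the mass entries sum
    to 1 ([moment_mass0]).  The quotient is expanded in [dispersion_expansion].

    What remains concerns the stiffness entries alone: they do not depend on h,
    and the coefficients of t^0 and t^2 vanish, i.e. N(t) = t^2 + O(t^4).  Each
    B-spline is a rescaled copy of one cardinal spline ([bsplineE]), whose
    derivative away from the integers is a difference of two splines of degree
    one less ([is_derive_csplineS]).  Hence A^{j+k} is minus the second difference
    of the Gram entries g_k of the splines of degree p - 1 ([stiffness_cross]), and
    summation by parts gives the t^0 and t^2 terms as soon as the g_k, over all
    integers k, have sum 1 ([cross_sum1]).  That sum is the integral of a
    cardinal spline by the partition of unity ([sum_cspline]).  This integral is
    found without calculus: pairing splines of degrees p and q, the sum of all
    their mutual inner products equals the integral of either one, so all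
    cardinal splines have the integral of the indicator of [0, 1[. *)

(** * Taylor expansion of the cosine *)

Section cos_taylor.
Context {R : realType}.
Implicit Types (x t : R) (n : nat).

Lemma series_exp_coeff_le_expR x n : 0 <= x -> series (exp_coeff x) n <= expR x.
Proof.
move=> x0; apply: nondecreasing_cvgn_le; last exact: is_cvg_series_exp_coeff.
by apply/nondecreasing_seqP => k; rewrite seriesSr lerDl exp_coeff_ge0.
Qed.

Lemma norm_cos_coeff_le x n : `|cos_coeff x n| <= exp_coeff `|x| n.
Proof.
rewrite /cos_coeff /exp_coeff /= -exprnP !normrM !normrX normfV !normr_nat.
rewrite ler_pM2r ?invr_gt0 ?ltr0n ?fact_gt0// ler_piMl ?exprn_ge0//.
by rewrite normrN1 expr1n mulr1; case: odd.
Qed.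

Lemma series_cos_coeffE x n :
  series (cos_coeff x) n.*2 = \sum_(0 <= m < n) (-1) ^+ m * x ^+ (2 * m) / ((2 * m)`!)%:R.
Proof.
elim: n => [|n IH]; first by rewrite /series /= !big_geq.
rewrite doubleS !seriesSr cos_coeff_odd addr0 IH big_nat_recr//=; congr (_ + _).
by rewrite -cos_coeff'E /cos_coeff' mul2n.
Qed.

(** The remainder is the tail of an absolutely convergent series, dominated term
    by term by the exponential series; since (2n + k)! >= k!, the factor
    |x|^(2n) comes out of the tail and what is left is at most exp |x|. *)
Lemma cos_taylor x n :
  `|cos x - \sum_(0 <= m < n) (-1) ^+ m * x ^+ (2 * m) / ((2 * m)`!)%:R|
    <= `|x| ^+ (2 * n) * expR `|x|.
Proof.
rewrite -series_cos_coeffE mul2n.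
have cv : (fun N => `|series (cos_coeff x) N - series (cos_coeff x) n.*2|) @ \oo
    --> `|cos x - series (cos_coeff x) n.*2|.
  apply: cvg_norm; apply: cvgB; last exact: cvg_cst.
  by rewrite unlock; exact: is_cvg_series_cos_coeff.
rewrite -(cvg_lim (@Rhausdorff R) cv); apply: limr_le; first exact: cvgP cv.
near=> N.
have nN : (n.*2 <= N)%N by near: N; exact: nbhs_infty_ge.
rewrite /series /= sub_series_geq//.
apply: (le_trans (ler_norm_sum _ _ _)).
apply: (@le_trans _ _ (\sum_(n.*2 <= k < N) `|x| ^+ n.*2 * exp_coeff `|x| (k - n.*2)%N)).
  apply: ler_sum_nat => k /andP[nk _].
  apply: (le_trans (norm_cos_coeff_le _ _)).
  rewrite /exp_coeff /= mulrA -exprD subnKC//.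
  rewrite ler_wpM2l ?exprn_ge0// lef_pV2 ?posrE ?ltr0n ?fact_gt0//.
  by rewrite ler_nat; apply: leq_fact; exact: leq_subr.
rewrite -mulr_sumr ler_wpM2l ?exprn_ge0//.
rewrite -{1}[n.*2]add0n big_addn.
under eq_bigr do rewrite addnK.
exact: series_exp_coeff_le_expR.
Unshelve. all: by end_near. Qed.

End cos_taylor.

(** * Expansion of the dispersion quotient *)

Section dispersion.
Context {R : realType} (p : nat).
Implicit Types (w : nat -> R) (t : R) (n m : nat).

(** Up to the sign (-1)^m, half the coefficient of t^(2m) in the symbol
    2 w_1 cos t + ... + 2 w_p cos (p t). *)
Definition moment w m : R :=
  \sum_(1 <= k < p.+1) (k%:R ^+ (2 * m) / ((2 * m)`!)%:R * w k).

Definition cosine_sum w t : R := \sum_(1 <= k < p.+1) w k * cos (k%:R * t).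

Lemma cosine_sum_taylor w n : exists2 C, 0 <= C & forall t, `|t| <= 1 ->
  `|cosine_sum w t - \sum_(0 <= m < n) (-1) ^+ m * moment w m * t ^+ (2 * m)|
    <= C * `|t| ^+ (2 * n).
Proof.
exists (\sum_(1 <= k < p.+1) `|w k| * (k%:R ^+ (2 * n) * expR k%:R)).
  apply: sumr_ge0 => k _; rewrite !mulr_ge0 ?exprn_ge0 ?expR_ge0//.
move=> t t1.
have -> : \sum_(0 <= m < n) (-1) ^+ m * moment w m * t ^+ (2 * m) =
    \sum_(1 <= k < p.+1) w k *
      \sum_(0 <= m < n) (-1) ^+ m * (k%:R * t) ^+ (2 * m) / ((2 * m)`!)%:R.
  under [RHS]eq_bigr do rewrite mulr_sumr.
  rewrite exchange_big/=; apply: eq_bigr => m _.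
  rewrite /moment mulr_sumr mulr_suml; apply: eq_bigr => k _.
  by rewrite exprMn; ring.
rewrite /cosine_sum -sumrB mulr_suml.
apply: (le_trans (ler_norm_sum _ _ _)); apply: ler_sum => k _.
rewrite -mulrBr normrM -mulrA ler_wpM2l//.
apply: (le_trans (cos_taylor _ _)).
rewrite normrM normr_nat exprMn mulrAC ler_wpM2r ?exprn_ge0//.
by rewrite ler_wpM2l ?exprn_ge0// ler_expR ler_piMr.
Qed.

(** With N and D the two symbols, N - t^2 D has in degree 2m + 2 a coefficient
    proportional to [moment A m.+1 + moment B m] for m >= 1, so the hypotheses
    cancel all degrees up to 2p + 2 and E is the coefficient in degree 2p + 4.
    Dividing by D keeps this leading term because D = 1 + O(t^2). *)
Lemma dispersion_expansion (A0 B0 : R) (A B : nat -> R) :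
    A0 + 2 * moment A 0 = 0 -> 2 * moment A 1 = -1 ->
    B0 + 2 * moment B 0 = 1 ->
    (forall m, (0 < m <= p)%N -> moment B m = - moment A m.+1) ->
  let E := 2 * (-1) ^+ p * (moment A p.+2 + moment B p.+1) in
  exists C d, 0 < d /\ forall t, `|t| <= d ->
    `|(A0 + 2 * cosine_sum A t) / (B0 + 2 * cosine_sum B t)
        - t ^+ 2 - E * t ^+ (2 * p.+2)| <= C * `|t| ^+ (2 * p.+3).
Proof.
move=> A0E A1E B0E BE E.
have [C1 C10 P1] := cosine_sum_taylor A p.+3.
have [C2 C20 P2] := cosine_sum_taylor B p.+2.
have [C3 C30 P3] := cosine_sum_taylor B 1.
(* The radius makes |1 - D| <= 1/2, so that 1 / D <= 2. *)
exists (2 * (2 * C1 + 2 * C2 + 2 * `|E| * C3)), (1 + 4 * C3)^-1.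
have c3 : 0 < 1 + 4 * C3 by rewrite ltr_pwDl// mulr_ge0.
split=> [|t td]; first by rewrite invr_gt0.
have t1 : `|t| <= 1.
  by apply: (le_trans td); rewrite invf_le1// lerDl mulr_ge0.
set N := A0 + _; set D := B0 + _.
have Dsmall : `|1 - D| <= 2 * C3 * `|t| ^+ 2.
  have := P3 _ t1; rewrite big_nat1 expr0 mul1r mulr1 muln1.
  have -> : 1 - D = - (2 * (cosine_sum B t - moment B 0)) by rewrite -[X in X - D]B0E /D; ring.
  by rewrite normrN normrM ger0_norm// -mulrA ler_pM2l.
have Dhalf : 2^-1 <= D.
  have : 2 * C3 * `|t| ^+ 2 <= 2^-1.
    have t2 : `|t| ^+ 2 <= (1 + 4 * C3)^-1.
      by apply: le_trans td; rewrite expr2 ler_piMr.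
    apply: (le_trans (ler_wpM2l _ t2)); first by rewrite mulr_ge0.
    by rewrite ler_pdivrMr//; lra.
  by move: Dsmall; rewrite ler_norml => /andP[_]; lra.
have D0 : 0 < D by apply: lt_le_trans Dhalf; rewrite invr_gt0.
have Nsmall : `|N - t ^+ 2 * D - E * t ^+ (2 * p.+2)|
    <= (2 * C1 + 2 * C2) * `|t| ^+ (2 * p.+3).
  have := P1 _ t1; have := P2 _ t1.
  set r2 := cosine_sum B t - _; set r1 := cosine_sum A t - _ => P2' P1'.
  have -> : N - t ^+ 2 * D - E * t ^+ (2 * p.+2) = 2 * r1 - t ^+ 2 * (2 * r2).
    suff poly : A0 + 2 * \sum_(0 <= m < p.+3) (-1) ^+ m * moment A m * t ^+ (2 * m)
        - t ^+ 2 * (B0 + 2 * \sum_(0 <= m < p.+2) (-1) ^+ m * moment B m * t ^+ (2 * m))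
        = E * t ^+ (2 * p.+2).
      by rewrite -poly /N /D /r1 /r2; ring.
    rewrite big_nat_recl// big_nat_recl//= big_nat_recr//=.
    rewrite [X in B0 + _ * X]big_nat_recl// [X in B0 + 2 * (_ + X)]big_nat_recr//=.
    have -> : \sum_(0 <= i < p) (-1) ^+ i.+1 * moment B i.+1 * t ^+ (2 * i.+1)
        = \sum_(0 <= i < p) (-1) ^+ i.+2 * moment A i.+2 * t ^+ (2 * i.+1).
      apply: eq_big_nat => m /andP[_ mp]; rewrite BE// (exprS _ m.+1); ring.
    have -> : \sum_(0 <= i < p) (-1) ^+ i.+2 * moment A i.+2 * t ^+ (2 * i.+2)
        = t ^+ 2 * \sum_(0 <= i < p) (-1) ^+ i.+2 * moment A i.+2 * t ^+ (2 * i.+1).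
      by rewrite mulr_sumr; apply: eq_bigr => i _; rewrite (mulnS 2 i.+1) exprD; ring.
    set S := \sum_(0 <= i < p) _.
    rewrite (mulnS 2 p.+1).
    transitivity ((A0 + 2 * moment A 0)
        - t ^+ 2 * (2 * moment A 1 + (B0 + 2 * moment B 0))
        + E * t ^+ (2 + 2 * p.+1)).
      by rewrite /E !exprS !exprD muln0 !expr0; ring.
    by rewrite A0E A1E B0E addNr mulr0 subr0 add0r.
  apply: (le_trans (ler_normB _ _)); rewrite (mulrDl (2 * C1)) lerD//.
    by rewrite normrM ger0_norm// -mulrA ler_pM2l.
  rewrite normrM (normrX 2) normrM (ger0_norm (ler0n _ 2)).
  rewrite (mulnS 2 p.+2).
  have := ler_wpM2l (exprn_ge0 2 (normr_ge0 t)) P2'.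
  by rewrite exprD => ?; nra.
clearbody E.
have -> : N / D - t ^+ 2 - E * t ^+ (2 * p.+2)
    = (N - t ^+ 2 * D - E * t ^+ (2 * p.+2) + E * t ^+ (2 * p.+2) * (1 - D)) / D.
  by field; rewrite gt_eqF.
rewrite normrM normfV (gtr0_norm D0) ler_pdivrMr//.
apply: (le_trans (ler_normD _ _)).
have -> : 2 * (2 * C1 + 2 * C2 + 2 * `|E| * C3) * `|t| ^+ (2 * p.+3) * D
   = (2 * C1 + 2 * C2 + 2 * `|E| * C3) * `|t| ^+ (2 * p.+3) * (2 * D) by ring.
apply: (@le_trans _ _ ((2 * C1 + 2 * C2 + 2 * `|E| * C3) * `|t| ^+ (2 * p.+3))).
  rewrite (mulrDl (2 * C1 + 2 * C2)) lerD// (normrM (_ * _)) (normrM E) (normrX (2 * p.+2)).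
  rewrite (mulnS 2 p.+2) exprD.
  have <- : `|E| * `|t| ^+ (2 * p.+2) * (2 * C3 * `|t| ^+ 2)
      = 2 * `|E| * C3 * (`|t| ^+ 2 * `|t| ^+ (2 * p.+2)) by ring.
  by rewrite ler_wpM2l// mulr_ge0// exprn_ge0.
rewrite ler_peMr//; last lra.
by rewrite mulr_ge0 ?exprn_ge0// !addr_ge0// ?mulr_ge0.
Qed.

End dispersion.

(** * Cardinal B-splines *)

Section cardinal_spline.
Context {R : realType}.
Implicit Types (x y h : R) (p q : nat) (j k : int).

(** The B-spline with knots 0, 1, ..., q + 1; every B-spline of degree q on a
    uniform grid is an affine rescaling of it ([bsplineE]). *)
Fixpoint cspline q y : R :=
  match q with
  | 0%N => if 0 <= y < 1 then 1 else 0
  | q'.+1 => (y * cspline q' y + (q'.+2%:R - y) * cspline q' (y - 1)) / q'.+1%:R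
  end.

Lemma csplineS q y : cspline q.+1 y =
  (y * cspline q y + (q.+2%:R - y) * cspline q (y - 1)) / q.+1%:R.
Proof. by []. Qed.

Lemma bsplineE h p j x : 0 < h -> bspline h p j x = cspline p (x / h - j%:~R).
Proof.
move=> h0; elim: p j => [|p IH] j; rewrite /knot.
  rewrite /= /knot intrD mulrDl mul1r; congr (if _ then _ else _).
  by rewrite subr_ge0 ltrBlDr ler_pdivlMr// ltr_pdivrMr// mulrDl mul1r addrC.
have knotD i n : knot h (i + n%:Z) = (i%:~R + n%:R) * h by rewrite /knot intrD.
rewrite csplineS /= !IH !knotD /knot.
have -> : x / h - (j + 1)%:~R = x / h - j%:~R - 1 by rewrite intrD; ring.
have p0 : p.+1%:R != 0 :> R by rewrite pnatr_eq0.
have -> : p.+2%:R = p.+1%:R + 1 :> R by rewrite -natr1.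
have -> : (j%:~R + p.+1%:R) * h - j%:~R * h = p.+1%:R * h by ring.
have -> : (j%:~R + (p.+1%:R + 1)) * h - (j%:~R + 1) * h = p.+1%:R * h by ring.
by move: (p.+1%:R) p0 => P P0; field; rewrite P0 gt_eqF.
Qed.

Lemma cspline_eq0 q y : ~~ (0 <= y < q.+1%:R) -> cspline q y = 0.
Proof.
elim: q y => [|q IH] y yq; first by rewrite /= (negbTE yq).
rewrite csplineS !IH ?mulr0 ?addr0 ?mul0r//.
- apply: contra yq => /andP[y0 yq]; rewrite -subr_ge0 in y0.
  move: yq; rewrite ltrBlDr natr1 => ->; rewrite andbT; lra.
- apply: contra yq => /andP[-> /=]/lt_trans; apply; by rewrite ltr_nat.
Qed.

(** Partition of unity.  In the recursion each [cspline q (y - i)] is collected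
    once from the term of index i and once from the term of index i - 1; its two
    weights y - i and q + 1 - (y - i) add up to q + 1.  The bounds on y make the
    two boundary terms vanish. *)
Lemma sum_cspline q n y : q%:R <= y < n%:R -> \sum_(i < n) cspline q (y - i%:R) = 1.
Proof.
elim: q n y => [|q IH] n y /andP[qy yn].
  have y0 : 0 <= y by [].
  have tn : (Num.truncn y < n)%N by rewrite truncn_lt_nat ?yn ?(lt_le_trans _ yn).
  have /andP[ty yt] := truncn_itv y0.
  rewrite (bigD1 (Ordinal tn))//= big1 ?addr0 => [|i it].
    by rewrite subr_ge0 ty ltrBlDr nat1r /= yt.
  rewrite subr_ge0 ltrBlDr nat1r -truncn_eq//.
  by case: eqP => // e; case/eqP: it; exact: val_inj.
have qy' : q%:R <= y by apply: le_trans qy; rewrite ler_nat.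
have sumq : \sum_(i < n) cspline q (y - i%:R) = 1 by rewrite IH// qy' yn.
rewrite -[RHS]sumq.
case: n yn {sumq} => [yn|n yn]; first by rewrite !big_ord0.
under eq_bigr => i _ do rewrite csplineS mulrDl.
rewrite big_split/= [X in _ + X]big_ord_recr/= [X in _ + (_ + X)](_ : _ = 0); last first.
  rewrite cspline_eq0 ?mulr0 ?mul0r// -addrA -opprD natr1 subr_ge0.
  by rewrite leNgt yn.
rewrite addr0 big_ord_recl/= [RHS]big_ord_recl/=.
rewrite !subr0 !(@cspline_eq0 q y) ?ltNge ?qy ?andbF// mulr0 mul0r !add0r -big_split/=.
apply: eq_bigr => i _; rewrite /bump /= add1n -natr1 opprD addrA.
have q0 : q.+1%:R != 0 :> R by rewrite pnatr_eq0.
by rewrite -(natr1 q.+1); move: (q.+1%:R) q0 => Q Q0; field.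
Qed.

End cardinal_spline.

Section cspline_derivative.
Context {R : realType}.
Implicit Types (x y : R) (q : nat).

Lemma is_derive_cspline0 x : x \isn't a Num.int -> is_derive x 1 (cspline 0) (0 : R).
Proof.
move=> xZ.
have x0 : x != 0 by apply: contraNneq xZ => ->.
have x1 : x != 1 by apply: contraNneq xZ => ->.
apply: (@near_eq_is_derive _ _ _ (cst (cspline 0 x))).
  case: (ltgtP x 0) x0 => // x0 _.
    near=> y.
    have y0 : y < 0 by near: y; exact: lt_nbhsl.
    by rewrite /= !leNgt y0 x0.
  case: (ltgtP x 1) x1 => // x1 _; near=> y.
    have y0 : 0 < y by near: y; exact: lt_nbhsr.
    have y1 : y < 1 by near: y; exact: lt_nbhsl.
    by rewrite /= !ltW// y1 x1.
  have y1 : 1 < y by near: y; exact: lt_nbhsr.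
  by rewrite /= !(ltNge _ 1) !(ltW x1) !(ltW y1) !andbF.
Unshelve. all: by end_near. Qed.

(** Differentiating the recursion of degree q + 1 and using the induction
    hypothesis leaves a combination of splines of degree q, and the recursion of
    degree q turns it into a multiple of the difference.  At the knots the
    formula fails for q = 0, when [cspline q.+1] is a hat function. *)
Lemma is_derive_csplineS q x : x \isn't a Num.int ->
  is_derive x 1 (cspline q.+1) (cspline q x - cspline q (x - 1)).
Proof.
have shift (f : R -> R) (y df : R) :
    is_derive (y - 1) 1 f df -> is_derive y 1 (fun z => f (z - 1)) df.
  move=> fdf; rewrite -[df]mulr1.
  have D1 : is_derive y (1 : R) (fun z => z - 1) (1 : R).
    by apply: is_derive_eq; rewrite subr0.
  exact: is_derive1_comp.
have recurrence q' (y d0 d1 : R) : is_derive y 1 (cspline q') d0 ->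
    is_derive (y - 1) 1 (cspline q') d1 ->
    is_derive y 1 (cspline q'.+1)
      ((cspline q' y + y * d0 - cspline q' (y - 1) + (q'.+2%:R - y) * d1) / q'.+1%:R).
  move=> D0 /shift D1.
  rewrite (_ : cspline q'.+1 = fun z => q'.+1%:R^-1 *:
    (z * cspline q' z + (q'.+2%:R - z) * cspline q' (z - 1))); last first.
    by apply/funext => z; rewrite csplineS mulrC.
  apply: is_derive_eq.
  rewrite /GRing.scale/=; ring.
elim: q x => [|q IH] x xZ;
  have x1Z : x - 1 \isn't a Num.int by rewrite rpredBr ?rpred1.
  have := recurrence 0%N x _ _ (is_derive_cspline0 xZ) (is_derive_cspline0 x1Z).
  by rewrite !mulr0 !addr0 divr1.
apply: is_derive_eq; first exact: (recurrence q.+1 x _ _ (IH _ xZ) (IH _ x1Z)).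
rewrite !csplineS.
have : q.+1%:R != 0 :> R by rewrite pnatr_eq0.
have : q.+2%:R != 0 :> R by rewrite pnatr_eq0.
rewrite -(natr1 q.+2) -(natr1 q.+1).
move: (q.+1%:R) => Q Q1 Q0; field; rewrite Q0 Q1//.
Qed.

End cspline_derivative.

(** * Lebesgue integrals of cardinal B-splines *)

Section lebesgue_Rintegral_lemmas.
Context {R : realType}.
Notation mu := (@lebesgue_measure R).
Implicit Types (f g : R -> R) (h c : R).

(** The two measures agree on the half-open intervals, which determines them. *)
Lemma lebesgue_measure_affine h c (A : set (measurableTypeR R)) : 0 < h -> measurable A ->
  pushforward mu (fun x : R => x / h - c : measurableTypeR R) A = (h%:E * mu A)%E.
Proof.
move=> h0 mA.
have mphi : measurable_fun [set: R] (fun x : measurableTypeR R => x / h - c : measurableTypeR R).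
  by apply: measurable_funB => //; apply: measurable_funM.
(* The image measure, packed with the proof that it is a measure. *)
unshelve epose (m := _ : {measure set (measurableTypeR R) -> \bar R}).
  refine (pushforward mu (fun x : measurableTypeR R => x / h - c : measurableTypeR R)); exact: mphi.
have hV0 : 0 <= h^-1 by rewrite invr_ge0 ltW.
have hE : (h%:E * (h^-1)%:E = 1)%E by rewrite -EFinM divff// gt_eqF.
suff -> : mu A = mscale (NngNum hV0) m A.
  by rewrite /mscale/= muleA hE mul1e.
apply: lebesgue_measure_unique => //= _ [[a b]] _ <-.
rewrite /mscale /= /pushforward /=.
have -> : (fun x => x / h - c) @^-1` `]a, b] = `](a + c) * h, (b + c) * h]%classic.
  apply/seteqP; split=> x /=; rewrite !in_itv/=;
    by rewrite ltrBrDr lerBlDr ltr_pdivlMr// ler_pdivrMr.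
rewrite !lebesgue_measure_itv/= !lte_fin ltr_pM2r// ltrD2r.
case: ifPn => _; last by rewrite mule0.
by rewrite -!EFinB -EFinM; congr EFin; field; rewrite gt_eqF.
Qed.

Lemma Rintegral_affine f h c : 0 < h -> mu.-integrable setT (EFin \o f) ->
  \int[mu]_x f (x / h - c) = h * \int[mu]_x f x.
Proof.
move=> h0 fi.
have mf : measurable_fun [set: R] (EFin \o f) by case/integrableP: fi.
have mphi : measurable_fun [set: R] (fun x : measurableTypeR R => x / h - c : measurableTypeR R).
  by apply: measurable_funB => //; apply: measurable_funM.
have scale (g : R -> \bar R) : measurable_fun [set: R] g -> (forall x, 0 <= g x)%E ->
    (\int[mu]_x g (x / h - c)%R = h%:E * \int[mu]_x g x)%E.
  move=> mg g0.
  have := @ge0_integral_pushforward _ _ (measurableTypeR R) (measurableTypeR R) R _ mphi mu setT g measurableT mg.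
  rewrite preimage_setT => <-//.
  have h0' : 0 <= h by exact: ltW.
  rewrite (@eq_measure_integral _ _ _ setT (mscale (NngNum h0') mu))//; last first.
    by move=> A mA _; rewrite /mscale/=; exact: lebesgue_measure_affine.
  by rewrite ge0_integral_mscale.
rewrite /Rintegral integralE [in RHS]integralE.
have -> : (EFin \o (fun x => f (x / h - c)%R))^\+%E = fun x => ((EFin \o f)^\+ (x / h - c)%R)%E.
  by apply/funext => x; rewrite !funeposE.
have -> : (EFin \o (fun x => f (x / h - c)%R))^\-%E = fun x => ((EFin \o f)^\- (x / h - c)%R)%E.
  by apply/funext => x; rewrite !funenegE.
rewrite scale//; last exact: measurable_funepos.
rewrite scale//; last exact: measurable_funeneg.
have fp := integrable_pos_fin_num measurableT fi; have fn := integrable_neg_fin_num measurableT fi.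
by rewrite -muleBr ?fineM ?fin_num_adde_defr// fin_numB fp.
Qed.

(** f inherits measurability from g, since on a countable set every function is
    measurable.  This absorbs the values of a derivative at the knots. *)
Lemma eq_Rintegral_off_countable f g (C : set R) : countable C -> measurable_fun [set: R] g ->
  (forall x, ~ C x -> f x = g x) -> \int[mu]_x f x = \int[mu]_x g x.
Proof.
move=> cC mg fg.
have mC : measurable C by apply: countable_measurable => // t; exact: measurable_set1.
have mf : measurable_fun [set: R] f.
  rewrite -(setUv C); apply/measurable_funU => //; first exact: measurableC.
  split.
    move=> _ Y mY; apply: countable_measurable; first by move=> t; exact: measurable_set1.
    by apply: sub_countable cC; apply: subset_card_le; exact: subIsetl.
  apply: (@eq_measurable_fun _ _ _ _ _ g).
    by move=> x; rewrite inE/= => /fg.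
  exact: measurable_funTS.
rewrite /Rintegral; congr fine; apply: ae_eq_integral => //.
- exact/measurable_EFinP.
- exact/measurable_EFinP.
exists C; split => //; first exact: countable_lebesgue_measure0.
by move=> x /= /not_implyP[_]; apply: contra_notP => /fg ->.
Qed.

End lebesgue_Rintegral_lemmas.

Section cspline_integrals.
Context {R : realType}.
Notation mu := (@lebesgue_measure R).
Implicit Types (x y a b : R) (p q : nat).

Lemma measurable_cspline q : measurable_fun [set: R] (@cspline R q).
Proof.
elim: q => [|q IH].
  apply: measurable_fun_ifT => //.
  apply: measurable_and; first exact: measurable_fun_ler.
  exact: measurable_fun_ltr.
apply: measurable_funM => //; apply: measurable_funD.
  exact: measurable_funM.
apply: measurable_funM; first exact: measurable_funB.
by apply: measurableT_comp => //; exact: measurable_funB.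
Qed.

Lemma cspline_bounded q : exists M, forall y, `|@cspline R q y| <= M.
Proof.
elim: q => [|q [M IH]].
  by exists 1 => y /=; case: ifP => _; rewrite ?normr1 ?normr0.
exists (q.+2%:R * (M + M)) => y.
have M0 : 0 <= M by apply: le_trans (IH 0).
have [yq|/cspline_eq0 ->] := boolP (0 <= y < q.+2%:R); last first.
  by rewrite normr0 mulr_ge0// addr_ge0.
case/andP: yq => y0 yq.
rewrite csplineS normrM normfV normr_nat ler_pdivrMr//.
apply: (@le_trans _ _ (q.+2%:R * (M + M))); last first.
  by rewrite ler_peMr ?ler1n// mulr_ge0// addr_ge0.
apply: (le_trans (ler_normD _ _)); rewrite mulrDr !normrM lerD// ler_pM//.
  by rewrite ger0_norm// ltW.
by rewrite ger0_norm ?lerBlDr ?lerDl ?subr_ge0 ?(ltW yq).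
Qed.

Lemma integrable_cspline p a :
  mu.-integrable setT (EFin \o (fun x => cspline p (x - a))).
Proof.
have mN : measurable_fun [set: R] (fun x => @cspline R p (x - a)).
  by apply: measurableT_comp (measurable_cspline p) _; exact: measurable_funB.
have -> : EFin \o (fun x => cspline p (x - a))
    = (EFin \o (fun x => cspline p (x - a))) \_ `[a, a + p.+1%:R].
  apply/funext => x; rewrite patchE; case: ifPn => //.
  rewrite notin_setE/= in_itv/= => /negP xa.
  rewrite cspline_eq0//; apply: contra xa => /andP[].
  by rewrite subr_ge0 ltrBlDl => -> /ltW.
apply/(integrable_mkcond _ _).1 => //.
apply: measurable_bounded_integrable => //.
- by rewrite /= lebesgue_measure_itv/= -EFinD; case: ifP => _; rewrite ltry.
- exact: measurable_funTS.
- have [M Mle] := cspline_bounded p.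
  exists M; split; first exact: num_real.
  by move=> M' /ltW MM' x _ /=; apply: le_trans MM'.
Qed.

Lemma integrable_cspline_mul p q a b :
  mu.-integrable setT (EFin \o (fun x => cspline p (x - a) * cspline q (x - b))).
Proof.
have [M Mle] := cspline_bounded q.
have mN : measurable_fun [set: R] (fun x => @cspline R q (x - b)).
  by apply: measurableT_comp (measurable_cspline q) _; exact: measurable_funB.
have bN : [bounded cspline q (x - b) | x in [set: R]].
  exists M; split; first exact: num_real.
  by move=> M' /ltW MM' x _ /=; apply: le_trans MM'.
have := integrableMl (measurableT) (integrable_cspline p a) mN bN.
by apply: eq_integrable => // x _; rewrite /= EFinM.
Qed.

End cspline_integrals.

Section cross_gram.
Context {R : realType}.
Notation mu := (@lebesgue_measure R).
Implicit Types (x y a b s h : R) (p q : nat).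

Definition cross p q s : R := \int[mu]_x (cspline p x * cspline q (x - s)).

Lemma integrable_cross p q s :
  mu.-integrable setT (EFin \o (fun x => cspline p x * cspline q (x - s))).
Proof.
have := integrable_cspline_mul p q 0 s.
by under [X in _ \o X]eq_fun do rewrite subr0.
Qed.

Lemma Rintegral_cspline_mul p q a b :
  \int[mu]_x (cspline p (x - a) * cspline q (x - b)) = cross p q (b - a).
Proof.
rewrite -[RHS]mul1r -(Rintegral_affine a ltr01 (integrable_cross p q (b - a))).
by apply: eq_Rintegral => x _; rewrite divr1 opprB addrA addrNK.
Qed.

Lemma crossC p q s : cross p q s = cross q p (- s).
Proof.
rewrite -sub0r -Rintegral_cspline_mul; apply: eq_Rintegral => x _.
by rewrite subr0 mulrC.
Qed.

Lemma cross_eq0 p q s : p.+1%:R <= s -> cross p q s = 0.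
Proof.
move=> ps; rewrite /cross; under eq_Rintegral => x _.
  have -> : cspline p x * cspline q (x - s) = 0.
    have [/andP[_ xp]|/cspline_eq0->] := boolP (0 <= x < p.+1%:R); last by rewrite mul0r.
    rewrite (@cspline_eq0 _ q) ?mulr0// subr_ge0 (lt_geF (lt_le_trans xp ps))//.
  over.
by rewrite Rintegral_cst// mul0r.
Qed.

Lemma Rintegral_sum n (f : 'I_n -> R -> R) :
  (forall i, mu.-integrable setT (EFin \o f i)) ->
  \int[mu]_x (\sum_(i < n) f i x) = \sum_(i < n) \int[mu]_x f i x.
Proof.
elim: n f => [|n IH] f fi.
  rewrite big_ord0; under eq_Rintegral do rewrite big_ord0.
  by rewrite Rintegral_cst// mul0r.
under eq_Rintegral do rewrite big_ord_recl.
rewrite RintegralD//.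
  by rewrite IH// big_ord_recl.
rewrite (_ : _ \o _ = (fun x => \sum_(i < n) (EFin \o f (lift ord0 i)) x)%E).
  exact: integrable_sum.
by apply/funext => x /=; rewrite sumEFin.
Qed.

(** The shifts occurring in the sum are all those for which the two supports
    meet, so the shifted factors add up to 1 on the support of [cspline p]. *)
Lemma sum_cross p q :
  \sum_(i < (p + q).+1) cross p q (i%:R - q%:R) = \int[mu]_x cspline p x.
Proof.
rewrite -Rintegral_sum; last by move=> i; exact: integrable_cross.
apply: eq_Rintegral => x _; rewrite -mulr_sumr.
have [/andP[x0 xp]|/cspline_eq0->] := boolP (0 <= x < p.+1%:R); last by rewrite mul0r.
under eq_bigr do rewrite opprB addrA addrAC.
rewrite -[RHS]mulr1; congr (_ * _).
under eq_bigr do rewrite addrAC.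
apply: sum_cspline; rewrite lerDr x0/=.
by rewrite -addSn natrD ltrD2r.
Qed.

(** By [crossC] the sum in [sum_cross] is symmetric in the two degrees, so all
    these integrals are equal; in degree 0 it is the length of [0, 1[. *)
Lemma Rintegral_cspline p : \int[mu]_x cspline p x = 1 :> R.
Proof.
have cspline_indep q q' : \int[mu]_x @cspline R q x = \int[mu]_x @cspline R q' x.
  rewrite -(sum_cross q q') -(sum_cross q' q) (reindex_inj rev_ord_inj)/=.
  rewrite addnC; apply: eq_bigr => i _; rewrite crossC; congr cross.
  rewrite opprB subSS natrB ?natrD; last by rewrite -ltnS.
  ring.
rewrite (cspline_indep p 0%N).
rewrite (_ : cspline 0 = \1_(`[0, 1[%classic : set R)) //; last first.
  apply/funext => x; rewrite indicE /= mem_setE.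
  by case: ifP => xx; rewrite in_itv/= xx.
rewrite /Rintegral integral_indic// setIT /= lebesgue_measure_itv/= lte_fin ltr01.
by rewrite -EFinB subr0.
Qed.

Lemma cross_sum1 q :
  cross q q 0 + 2 * \sum_(1 <= m < q.+1) cross q q m%:R = 1.
Proof.
rewrite -[RHS](Rintegral_cspline q) -(sum_cross q q).
rewrite -(big_mkord xpredT (fun i => cross q q (i%:R - q%:R))).
rewrite [RHS](@big_cat_nat _ _ _ q) ?leqW ?leq_addr//=.
rewrite [X in _ = _ + X]big_ltn ?ltnS ?leq_addr// subrr.
have -> : \sum_(0 <= i < q) cross q q (i%:R - q%:R) = \sum_(1 <= m < q.+1) cross q q m%:R.
  rewrite big_nat_rev big_add1/=; apply: eq_big_nat => i /andP[_ iq].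
  by rewrite crossC add0n natrB//; congr cross; ring.
have -> : \sum_(q.+1 <= i < (q + q).+1) cross q q (i%:R - q%:R)
    = \sum_(1 <= m < q.+1) cross q q m%:R.
  rewrite -{1}(add1n q) big_addn -addSn addnK.
  by apply: eq_bigr => i _; rewrite natrD addrK.
ring.
Qed.

End cross_gram.

(** * The stiffness entries *)

Section stiffness.
Context {R : realType}.
Notation mu := (@lebesgue_measure R).
Implicit Types (h : R) (j k : int) (q : nat).

Lemma derive1_bspline h q j (x : R) : 0 < h -> x / h \isn't a Num.int ->
  derive1 (bspline h q.+1 j) x
  = h^-1 * (cspline q (x / h - j%:~R) - cspline q (x / h - (j%:~R + 1))).
Proof.
move=> h0 xZ; have -> : bspline h q.+1 j = fun x => cspline q.+1 (x / h - j%:~R).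
  by apply/funext => y; exact: bsplineE.
rewrite derive1E opprD addrA mulrC.
have xjZ : x / h - j%:~R \isn't a Num.int by rewrite rpredBr ?intr_int.
have D1 : is_derive x (1 : R) (fun z => z / h - j%:~R) (h^-1 : R).
  rewrite (_ : (fun z : R => z / h - j%:~R) = fun z => h^-1 *: z - j%:~R).
    by apply: is_derive_eq; rewrite subr0 /GRing.scale/= mulr1.
  by apply/funext => z; rewrite mulrC.
have D2 := is_derive_csplineS q xjZ.
have D : is_derive x (1 : R) (fun y => cspline q.+1 (y / h - j%:~R))
    ((cspline q (x / h - j%:~R) - cspline q (x / h - j%:~R - 1)) * h^-1).
  exact: is_derive1_comp.
exact: derive_val.
Qed.

(** Both derivatives are differences of splines of degree q, so their product
    integrates to a second difference of the Gram entries; the powers of h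
    cancel, and with them the dependence on h. *)
Lemma stiffness_cross h q j k : 0 < h ->
  stiffness h q.+1 j k =
    2 * cross q q k%:~R - cross q q (k%:~R + 1) - cross q q (k%:~R - 1).
Proof.
move=> h0.
pose F (x : R) : R := (cspline q x - cspline q (x - 1)) *
  (cspline q (x - k%:~R) - cspline q (x - (k%:~R + 1))).
have FE : F = fun x => cspline q x * cspline q (x - k%:~R)
  - cspline q x * cspline q (x - (k%:~R + 1))
  - (cspline q (x - 1) * cspline q (x - k%:~R)
     - cspline q (x - 1) * cspline q (x - (k%:~R + 1))).
  by apply/funext => x; rewrite /F; ring.
pose r : R := k%:~R.
have i1 := integrable_cross q q r.
have i2 := integrable_cross q q (r + 1).
have i3 := integrable_cspline_mul q q 1 r.
have i4 := integrable_cspline_mul q q 1 (r + 1).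
have iB (u v : R -> R) : mu.-integrable setT (EFin \o u) -> mu.-integrable setT (EFin \o v) ->
    mu.-integrable setT (EFin \o (fun x => u x - v x)).
  move=> iu iv; have := integrableB measurableT iu iv.
  by apply: eq_integrable => // x _; rewrite /= EFinB.
have i12 := iB _ _ i1 i2.
have i34 := iB _ _ i3 i4.
have Fi : mu.-integrable setT (EFin \o F).
  by rewrite FE; exact: iB _ _ i12 i34.
have intF : \int[mu]_x F x
    = 2 * cross q q k%:~R - cross q q (k%:~R + 1) - cross q q (k%:~R - 1).
  rewrite FE RintegralB// RintegralB// RintegralB// !Rintegral_cspline_mul addrK.
  rewrite -!/(cross _ _ _); ring.
have mF : measurable_fun [set: R] F.
  have mN c : measurable_fun [set: R] (fun x => @cspline R q (x - c)).
    by apply: measurableT_comp (measurable_cspline q) _; exact: measurable_funB.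
  apply: measurable_funM; apply: measurable_funB => //; exact: measurable_cspline.
pose G x := h^-1 ^+ 2 * F x.
have Gi : mu.-integrable setT (EFin \o G).
  by rewrite (_ : _ \o G = fun x => (h^-1 ^+ 2)%:E * (F x)%:E)%E//; exact: integrableZl.
rewrite -intF /stiffness.
transitivity (h * \int[mu]_x G (x / h - j%:~R)); last first.
  rewrite Rintegral_affine// RintegralZl// /=; field; rewrite gt_eqF//.
(* Away from the knots both derivatives exist. *)
congr (_ * _); apply: (@eq_Rintegral_off_countable _ _ _ (range (fun i : int => i%:~R * h))).
- by apply: (card_le_trans (card_image_le _ _)); exact: countableP.
- apply: measurableT_comp (_ : measurable_fun [set: R] G) _.
    by apply: measurable_funM.
  by apply: measurable_funB => //; apply: measurable_funM.
move=> x /= xC.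
have xZ : x / h \isn't a Num.int.
  apply/negP => /intrP[i xi]; apply: xC; exists i => //.
  by rewrite -xi divfK// gt_eqF.
rewrite !derive1_bspline// /G /F intrD.
rewrite -!addrA -!opprD !addrA; ring.
Qed.

End stiffness.

(** * Moments of the stiffness and mass entries *)

Section second_difference.
Context {R : realType}.
Implicit Types (G : nat -> R) (n : nat).

Lemma sum_second_difference G n :
  \sum_(1 <= k < n.+1) (2 * G k - G k.+1 - G k.-1) = G n - G n.+1 - (G 0%N - G 1%N).
Proof.
elim: n => [|n IH]; first by rewrite big_geq// subrr.
by rewrite big_nat_recr//= IH; ring.
Qed.

(** Summation by parts: the second difference of k^2 is 2. *)
Lemma sum_sqr_second_difference G n :
  \sum_(1 <= k < n.+1) k%:R ^+ 2 * (2 * G k - G k.+1 - G k.-1) =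
    - (G 0%N + 2 * \sum_(1 <= m < n.+1) G m)
    + n.+1%:R ^+ 2 * G n - n%:R ^+ 2 * G n.+1.
Proof.
elim: n => [|n IH]; first by rewrite !big_geq//; ring.
by rewrite big_nat_recr//= IH [in RHS]big_nat_recr//= -(natr1 n.+1) -(natr1 n); ring.
Qed.

End second_difference.

Section coefficients.
Context {R : realType}.
Implicit Types (h : R) (j k : int) (p q m n : nat).

Lemma stiffness_scale h p j k : 0 < h -> (0 < p)%N -> stiffness h p j k = stiffness 1 p j k.
Proof.
case: p => [|q] h0 p0; first by exfalso.
by rewrite (stiffness_cross _ _ _ h0) (stiffness_cross _ _ _ ltr01).
Qed.

Lemma mass_opt_scale h p j k : 0 < h -> (0 < p)%N -> mass_opt h p j k = mass_opt 1 p j k.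
Proof.
move=> h0 p0; rewrite /mass_opt; suff -> : mass_vec h p j = mass_vec 1 p j by [].
congr (_ *m - (_ *m _)); apply/colP => i; rewrite !mxE; exact: stiffness_scale.
Qed.

Lemma stiffness_nat h q j (n : nat) : 0 < h -> (0 < n)%N ->
  stiffness h q.+1 j n%:Z =
    2 * cross q q n%:R - cross q q n.+1%:R - cross q q n.-1%:R.
Proof.
move=> h0; case: n => // n _; rewrite stiffness_cross// -pmulrn natr1.
by rewrite -[in cross q q (n.+1%:R - 1)]natr1 addrK.
Qed.

Lemma cross_nat_eq0 p q (n : nat) : (p < n)%N -> cross p q n%:R = 0 :> R.
Proof. by move=> pn; apply: cross_eq0; rewrite ler_nat. Qed.

(** The symbol of the stiffness entries vanishes at frequency 0, being the sum of
    all second differences of a finitely supported sequence. *)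
Lemma moment_stiffness0 h p j : 0 < h -> (0 < p)%N ->
  stiffness h p j 0 + 2 * moment p (fun n => stiffness h p j n%:Z) 0 = 0.
Proof.
case: p => [|q] h0 p0; first by exfalso.
rewrite /moment.
under eq_big_nat => k /andP[k0 _].
  rewrite muln0 expr0 fact0 divr1 mul1r stiffness_nat//; over.
rewrite (sum_second_difference (fun n => cross q q n%:R)).
rewrite stiffness_cross// sub0r add0r -crossC.
rewrite (cross_nat_eq0 _ (leqnn q.+1)) (cross_nat_eq0 _ (leqnSn q.+1)); ring.
Qed.

(** The symbol of the stiffness entries is t^2 + O(t^4): summation by parts
    reduces this to the Gram entries having total sum 1. *)
Lemma moment_stiffness1 h p j : 0 < h -> (0 < p)%N ->
  2 * moment p (fun n => stiffness h p j n%:Z) 1 = -1.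
Proof.
case: p => [|q] h0 p0; first by exfalso.
rewrite /moment mulr_sumr.
under eq_big_nat => k /andP[k0 _].
  rewrite stiffness_nat// mulrA mulrCA divff ?mulr1; last by [].
  over.
rewrite (sum_sqr_second_difference (fun n => cross q q n%:R)).
rewrite big_nat_recr//= (cross_nat_eq0 _ (leqnn q.+1)) (cross_nat_eq0 _ (leqnSn q.+1)).
by rewrite !mulr0 !addr0 subr0 cross_sum1.
Qed.

Lemma mass_optE h p j (i : 'I_p) : mass_opt h p j i.+1%:Z = mass_vec h p j i ord0.
Proof. by rewrite /mass_opt /= insubT//= => ip; congr (mass_vec _ _ _ _ _); exact: val_inj. Qed.

Lemma moment_ord p (w : nat -> R) m :
  moment p w m = \sum_(i < p) i.+1%:R ^+ (2 * m) / ((2 * m)`!)%:R * w i.+1.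
Proof. by rewrite /moment big_add1/= big_mkord. Qed.

Lemma moment_mass0 h p j :
  mass_opt h p j 0 + 2 * moment p (fun n => mass_opt h p j n%:Z) 0 = 1.
Proof.
rewrite moment_ord; under eq_bigr do rewrite muln0 expr0 fact0 divr1 mul1r mass_optE.
by rewrite /mass_opt/= subrK.
Qed.

(** Row m of the linear system defining the mass entries. *)
Lemma moment_mass h p j m : (0 < m <= p)%N ->
  moment p (fun n => mass_opt h p j n%:Z) m
    = - moment p (fun n => stiffness h p j n%:Z) m.+1.
Proof.
case: m => //= m mp.
have /colP/(_ (Ordinal mp)) := (mass_vecP h j _).2 (erefl (mass_vec h p j)).
rewrite !mxE !moment_ord => sys.
under eq_bigr do rewrite mass_optE.
transitivity (\sum_(k < p) aleph R p (Ordinal mp) k * mass_vec h p j k ord0).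
  by apply: eq_bigr => i _; rewrite [aleph _ _ _ _]mxE.
rewrite sys; congr (- _); apply: eq_bigr => i _.
rewrite [aleph_tilde _ _ _ _]mxE [stiffness_vec _ _ _ _ _]mxE.
by rewrite (mulnS 2 m.+1) addnC.
Qed.

End coefficients.

(** * The dispersion error *)

Theorem theorem2 (R : realType) (p : nat) (mu : R) (j : int)
    (hp : (1 <= p)%N) (hmu : mu != 0) :
  (fun h : R => omega_sq p mu j h - mu ^+ 2) =
  (fun h : R =>
     2 * (-1) ^+ p
       * (\sum_(1 <= k < p.+1)
            (k%:R ^+ (2 * p + 4) / ((2 * p + 4)`!)%:R * stiffness h p j k%:Z
             + k%:R ^+ (2 * p + 2) / ((2 * p + 2)`!)%:R * mass_opt h p j k%:Z))
       * mu ^+ (2 * p + 4) * h ^+ (2 * p + 2))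
  +O_ (0^'+) (fun h : R => h ^+ (2 * p + 4)).
Proof.
(* The expansion is applied at mesh size 1, the entries being independent of h > 0. *)
have [C [d [d0 expansion]]] := dispersion_expansion
  (moment_stiffness0 j ltr01 hp) (moment_stiffness1 j ltr01 hp)
  (moment_mass0 1 p j) (fun m => @moment_mass R 1 p j m).
apply/eqaddOP/bigO_exP; exists (`|C| * `|mu| ^+ (2 * p.+3) + 1).
  by rewrite ltr_wpDl// mulr_ge0// exprn_ge0.
near=> h.
have h0 : 0 < h by near: h; exact: nbhs_right_gt.
have td : `|mu * h| <= d.
  rewrite normrM (gtr0_norm h0) mulrC -ler_pdivlMr ?normr_gt0//.
  by near: h; apply: nbhs_right_le; rewrite divr_gt0// normr_gt0.
have e4 : (2 * p + 4 = 2 * p.+2)%N by rewrite !mulnS addnA addnC.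
have e2 : (2 * p + 2 = 2 * p.+1)%N by rewrite mulnS addnC.
have h2 : 0 < h ^+ 2 by rewrite exprn_gt0.
have := expansion _ td; set T := (X in `|X| <= _) => leT.
have -> : ((fun h : R => omega_sq p mu j h - mu ^+ 2) - (fun h : R =>
     2 * (-1) ^+ p
       * (\sum_(1 <= k < p.+1)
            (k%:R ^+ (2 * p + 4) / ((2 * p + 4)`!)%:R * stiffness h p j k%:Z
             + k%:R ^+ (2 * p + 2) / ((2 * p + 2)`!)%:R * mass_opt h p j k%:Z))
       * mu ^+ (2 * p + 4) * h ^+ (2 * p + 2))) h = (h ^+ 2)^-1 * T.
  have cosE (w : R -> int -> R) : w h =1 w 1 ->
      \sum_(1 <= k < p.+1) w h k%:Z * cos (k%:R * mu * h)
      = cosine_sum p (fun k => w 1 k%:Z) (mu * h).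
    by move=> ww; apply: eq_bigr => k _; rewrite ww mulrA.
  have scaleA : stiffness h p j =1 stiffness 1 p j by move=> k; exact: stiffness_scale.
  have scaleB : mass_opt h p j =1 mass_opt 1 p j by move=> k; exact: mass_opt_scale.
  rewrite !fctE /omega_sq.
  rewrite (cosE (fun h => stiffness h p j))// (cosE (fun h => mass_opt h p j))//.
  rewrite scaleA scaleB.
  have -> : \sum_(1 <= k < p.+1)
      (k%:R ^+ (2 * p + 4) / ((2 * p + 4)`!)%:R * stiffness h p j k%:Z
       + k%:R ^+ (2 * p + 2) / ((2 * p + 2)`!)%:R * mass_opt h p j k%:Z)
      = moment p (fun k => stiffness 1 p j k%:Z) p.+2
        + moment p (fun k => mass_opt 1 p j k%:Z) p.+1.
    rewrite -big_split/=.
    by apply: eq_bigr => k _; rewrite scaleA scaleB e4 e2.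
  rewrite e4 e2 /T (_ : (2 * p.+2 = 2 + 2 * p.+1)%N); last exact: mulnS.
  (* With the quotient of the symbols abstracted, only h != 0 is left to check. *)
  set Q := (X in X - (mu * h) ^+ 2).
  by rewrite -/Q !exprMn !exprD; field; rewrite gt_eqF.
rewrite normrM normfV (gtr0_norm h2) mulrC ler_pdivrMr// normrX (gtr0_norm h0).
apply: (le_trans leT); apply: (le_trans (ler_wpM2r _ (ler_norm C))).
  exact: exprn_ge0.
have -> : (2 * p.+3 = 2 * p + 4 + 2)%N by rewrite e4 mulnS addnC.
move: (2 * p + 4)%N => m.
rewrite normrM (gtr0_norm h0) exprMn (exprD h) mulrA -[X in _ <= X]mulrA.
by rewrite ler_wpM2r ?lerDl// mulr_ge0 ?exprn_ge0// ltW.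
Unshelve. all: by end_near. Qed.
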